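(* Let $\mathcal{T}=(t_{ijkl})$ be a real $4$th-order $3$-dimensional symmetric tensor such that, for all pairwise distinct $i,j,k\in\{1,2,3\}$, $t_{iiii}=1$, $t_{iiij}=1$, $t_{iijk}=-1$ and $t_{iijj}\in\{-1,0,1\}$. Then $\mathcal{T}$ is strictly copositive if and only if $t_{iijj}\in\{0,1\}$ for all $i,j\in\{1,2,3\}$ with $i\neq j$ and at least two of the three entries $t_{1122},t_{1133},t_{2233}$ are equal to $1$.
   Context: A real $4$th-order $3$-dimensional tensor $\mathcal{T}=(t_{ijkl})$, $1\le i,j,k,l\le 3$, is symmetric if its entries are invariant under all permutations of the indices. For $x\in\mathbb{R}^3$, $\mathcal{T}x^4=\sum_{i,j,k,l=1}^3 t_{ijkl}x_ix_jx_kx_l$. $\mathcal{T}$ is strictly copositive if $\mathcal{T}x^4>0$ for every nonzero $x\in\mathbb{R}^3$ with all coordinates nonnegative. *)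

(* Defs.v *)
From mathcomp Require Import all_boot all_order all_algebra.
From mathcomp Require Import reals.

Set Implicit Arguments.
Unset Strict Implicit.
Unset Printing Implicit Defensive.

Import Order.TTheory GRing.Theory Num.Theory.
Local Open Scope ring_scope.

Definition tensor4 (R : realType) (n : nat) : Type :=
  'I_n -> 'I_n -> 'I_n -> 'I_n -> R.

(* perm_eq index lists are exactly the rearrangements of (i, j, k, l). *)
Definition tensor4_symmetric (R : realType) (n : nat) (T : tensor4 R n) : Prop :=
  forall i j k l i' j' k' l' : 'I_n,
    perm_eq [:: i; j; k; l] [:: i'; j'; k'; l'] ->
    T i j k l = T i' j' k' l'.

Definition tensor4_form (R : realType) (n : nat) (T : tensor4 R n)
    (x : 'rV[R]_n) : R :=
  \sum_(i < n) \sum_(j < n) \sum_(k < n) \sum_(l < n)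
    T i j k l * x 0 i * x 0 j * x 0 k * x 0 l.

Definition strictly_copositive (R : realType) (n : nat) (T : tensor4 R n) : Prop :=
  forall x : 'rV[R]_n,
    x != 0 -> (forall i : 'I_n, 0 <= x 0 i) -> 0 < tensor4_form T x.

(* Main.v *)
(** With [s = x + y + z], the form equals
    [s^4 - 24 x y z s
       - 6 ((1 - a) x^2 y^2 + (1 - b) x^2 z^2 + (1 - c) y^2 z^2)],
    where [a, b, c] are the entries [t1122], [t1133], [t2233]. At [(1, 1, 1)]
    its value is [6 (a + b + c) - 9], which forces [a + b + c >= 2].
    Conversely, if say [a = b = 1], then it is enough to treat [c = 0]; for fixed
    [x] and [y + z] the form is then smallest at [y = z], which leaves a quartic
    in two variables. *)
Require Import Defs.
From mathcomp Require Import all_boot all_order all_algebra.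
From mathcomp Require Import reals.
From mathcomp Require Import ring lra.

Set Implicit Arguments.
Unset Strict Implicit.
Unset Printing Implicit Defensive.

Import Order.TTheory GRing.Theory Num.Theory.
Local Open Scope ring_scope.

Lemma sum_ord3 (V : nmodType) (F : 'I_3 -> V) :
  \sum_(i < 3) F i = F 0 + F 1 + F 2.
Proof.
rewrite !big_ord_recr big_ord0 /= add0r.
by congr (F _ + F _ + F _); apply/val_inj.
Qed.

Lemma ord3P (i : 'I_3) : [\/ i = 0, i = 1 | i = 2].
Proof.
by case: i => -[|[|[|//]]] i3; [apply: Or31|apply: Or32|apply: Or33];
  apply: val_inj.
Qed.

(* The constant [5 / 12] is a rational slightly above [1 / sqrt 6], where
   [4 x^3 - 2 x s^2 + (5 / 8) s^3] attains its minimum over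
   [x >= 0] for [s = 1]. *)
Lemma binary_quartic_gt0 (R : realFieldType) (x s : R) :
  0 <= x -> 0 <= s -> 0 < x + s ->
  0 < x ^+ 4 + 4 * x ^+ 3 * s - 2 * x * s ^+ 3 + 5 / 8 * s ^+ 4.
Proof.
move=> x0 s0 xs0.
(* With [t = 5 / 12 * s], [(x - t)^2 (x + 2 t) = x^3 - 3 t^2 x + 2 t^3] absorbs the negative term
   and leaves nonnegative remainders. *)
have -> : x ^+ 4 + 4 * x ^+ 3 * s - 2 * x * s ^+ 3 + 5 / 8 * s ^+ 4 =
    4 * s * (x - 5 / 12 * s) ^+ 2 * (x + 5 / 6 * s) + x * s ^+ 3 / 12
    + (x ^+ 4 + 5 / 108 * s ^+ 4) by field.
apply: ltr_wpDl.
  have := exprn_ge0 3 s0; have := sqr_ge0 (x - 5 / 12 * s) => q0 c0.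
  have xs_ge0 : 0 <= x + 5 / 6 * s by lra.
  have : 0 <= s * (x - 5 / 12 * s) ^+ 2 * (x + 5 / 6 * s).
    by apply: mulr_ge0 => //; apply: mulr_ge0.
  by have := mulr_ge0 x0 c0; lra.
have := exprn_ge0 4 x0; have := exprn_ge0 4 s0.
have [x_gt0|x_le0] := ltrP 0 x.
  by have := exprn_gt0 4 x_gt0; lra.
have s_gt0 : 0 < s by lra.
by have := exprn_gt0 4 s_gt0; lra.
Qed.

(** This is the case [a = b = 1], [c = 0]. Substituting [y z = (s^2 - (y - z)^2) / 4] with
    [s = y + z] gives the value at [y = z = s / 2], a binary quartic, plus [(y - z)^2] times a
    nonnegative factor. *)
Lemma ternary_quartic_gt0 (R : realFieldType) (x y z : R) :
  0 <= x -> 0 <= y -> 0 <= z -> 0 < x + y + z ->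
  0 < (x + y + z) ^+ 4 - 24 * x * y * z * (x + y + z) - 6 * (y * z) ^+ 2.
Proof.
move=> x0 y0 z0 s0; pose s := y + z.
have s_ge0 : 0 <= s by rewrite addr_ge0.
have -> : (x + y + z) ^+ 4 - 24 * x * y * z * (x + y + z) - 6 * (y * z) ^+ 2 =
    (x ^+ 4 + 4 * x ^+ 3 * s - 2 * x * s ^+ 3 + 5 / 8 * s ^+ 4)
    + (y - z) ^+ 2 * (6 * x * (x + s) + 6 / 4 * (s ^+ 2 / 4 + y * z)).
  by rewrite /s; field.
rewrite ltr_pwDl //; first by apply: binary_quartic_gt0; rewrite // /s addrA.
apply: mulr_ge0; first exact: sqr_ge0.
have := mulr_ge0 x0 (addr_ge0 x0 s_ge0); have := mulr_ge0 y0 z0.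
by have := sqr_ge0 s; lra.
Qed.

Section Form.
Variables (R : realType) (T : tensor4 R 3).
Hypothesis Tsym : tensor4_symmetric T.
Hypothesis Tentries : forall i j k : 'I_3, i != j -> i != k -> j != k ->
  [/\ T i i i i = 1, T i i i j = 1, T i i j k = -1
    & T i i j j \in [:: -1; 0; 1]].

Lemma entries_iiij (i j k : 'I_3) : i != j -> i != k -> j != k ->
  (T i i i i = 1) * ((T i i i j = 1) * (T i i j i = 1) *
  (T i j i i = 1) * (T j i i i = 1)).
Proof.
move=> ij ik jk; have [h1 h2 _ _] := Tentries ij ik jk.
by split=> //; do !split; rewrite -?h2 //; apply: Tsym;
  (* Two lists are permutations of each other when every predicate has the same count on both, here
     an identity between sums of naturals. *)
  apply/permP => P /=; ring.
Qed.

Lemma entries_iijk (i j k : 'I_3) : i != j -> i != k -> j != k ->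
  (T i i j k = -1) * (T i j i k = -1) * (T i j k i = -1) *
  (T j i i k = -1) * (T j i k i = -1) * (T j k i i = -1).
Proof.
move=> ij ik jk; have [_ _ h _] := Tentries ij ik jk.
by do !split; rewrite -?h //; apply: Tsym; apply/permP => P /=; ring.
Qed.

Lemma entries_iijj (i j : 'I_3) :
  (T i j i j = T i i j j) * (T i j j i = T i i j j) *
  (T j i i j = T i i j j) * (T j i j i = T i i j j) *
  (T j j i i = T i i j j).
Proof.
by do !split; apply: Tsym; apply/permP => P /=; ring.
Qed.

(** If all entries were 1, the form would be [s ^+ 4]. Each of the 12 arrangements of [iijk] lowers
    its term by 2, and the sum over [i] produces the factor [s]; each of the 6 arrangements of
    [iijj] lowers its term by [1 - T i i j j] times the monomial. *)
Lemma tensor4_formE (x : 'rV[R]_3) :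
  let s := x 0 0 + x 0 1 + x 0 2 in
  tensor4_form T x = s ^+ 4 - 24 * x 0 0 * x 0 1 * x 0 2 * s
    - 6 * ((1 - T 0 0 1 1) * (x 0 0 * x 0 1) ^+ 2
         + (1 - T 0 0 2 2) * (x 0 0 * x 0 2) ^+ 2
         + (1 - T 1 1 2 2) * (x 0 1 * x 0 2) ^+ 2).
Proof.
have r3 := (@entries_iiij 0 1 2 isT isT isT, @entries_iiij 0 2 1 isT isT isT,
  @entries_iiij 1 0 2 isT isT isT, @entries_iiij 1 2 0 isT isT isT,
  @entries_iiij 2 0 1 isT isT isT, @entries_iiij 2 1 0 isT isT isT).
have r2 := (@entries_iijk 0 1 2 isT isT isT, @entries_iijk 0 2 1 isT isT isT,
  @entries_iijk 1 0 2 isT isT isT, @entries_iijk 1 2 0 isT isT isT,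
  @entries_iijk 2 0 1 isT isT isT, @entries_iijk 2 1 0 isT isT isT).
have r1 := (entries_iijj 0 1, entries_iijj 0 2, entries_iijj 1 2).
rewrite /tensor4_form !sum_ord3 !r3 !r2 !r1 /=.
ring.
Qed.

End Form.

Theorem theorem3p6 (R : realType) (T : tensor4 R 3)
    (Tsym : tensor4_symmetric T)
    (Tentries : forall i j k : 'I_3, i != j -> i != k -> j != k ->
       [/\ T i i i i = 1, T i i i j = 1, T i i j k = -1
         & T i i j j \in [:: -1; 0; 1]]) :
  strictly_copositive T <->
  (forall i j : 'I_3, i != j -> T i i j j \in [:: 0; 1]) /\
  (2 <= count_mem (1 : R)%R [:: T 0 0 1 1; T 0 0 2 2; T 1 1 2 2]%R)%N.
Proof.
have formE := tensor4_formE Tsym Tentries.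
split=> [Tpos|[T01 Tcount] x x_neq0 x_ge0].
  have : 0 < tensor4_form T (const_mx 1).
    apply: Tpos => [|i]; last by rewrite mxE.
    by apply/eqP => /rowP/(_ 0)/eqP; rewrite !mxE oner_eq0.
  rewrite formE !mxE => T111.
  have [_ _ _ a3] := Tentries 0 1 2 isT isT isT.
  have [_ _ _ b3] := Tentries 0 2 1 isT isT isT.
  have [_ _ _ c3] := Tentries 1 2 0 isT isT isT.
  have [[a01 b01 c01] count2] : [/\ T 0 0 1 1 \in [:: 0; 1],
      T 0 0 2 2 \in [:: 0; 1] & T 1 1 2 2 \in [:: 0; 1]] /\
      (2 <= count_mem (1 : R)%R [:: T 0 0 1 1; T 0 0 2 2; T 1 1 2 2]%R)%N.
    rewrite /= !inE in a3 b3 c3 *.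
    move: (T 0 0 1 1) (T 0 0 2 2) (T 1 1 2 2) a3 b3 c3 T111 => a b c.
    (* An entry -1, or fewer than two entries 1, makes [a + b + c] at most 1, against [T111]. *)
    by move=> /or3P[]/eqP-> /or3P[]/eqP-> /or3P[]/eqP->;
      rewrite ?eqxx ?[0 == 1]eq_sym ?oner_eq0 ?orbT // => T111; exfalso; lra.
  split=> // i j; have symT := (entries_iijj Tsym).
  by case: (ord3P i) => ->; case: (ord3P j) => -> //; rewrite symT.
have [x0 x1 x2] := And3 (x_ge0 0) (x_ge0 1) (x_ge0 2).
have s_gt0 : 0 < x 0 0 + x 0 1 + x 0 2.
  rewrite lt0r !addr_ge0 // andbT; apply: contraNneq x_neq0 => s0.
  apply/eqP/rowP => i; rewrite mxE; case: (ord3P i) => ->; lra.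
rewrite formE; move: Tcount.
have := T01 0 1 isT; have := T01 0 2 isT; have := T01 1 2 isT.
move: x0 x1 x2 s_gt0; move: (x 0 0) (x 0 1) (x 0 2) => u v w u0 v0 w0 s0.
(* One inequality for each choice of the entry that may vanish: [c], then [b], then [a]. *)
have uvw := ternary_quartic_gt0 u0 v0 w0 s0.
have vuw : 0 < (u + v + w) ^+ 4 - 24 * u * v * w * (u + v + w)
    - 6 * (u * w) ^+ 2.
  have := @ternary_quartic_gt0 _ v u w v0 u0 w0; rewrite (addrC v u).
  by rewrite [24 * v * u]mulrAC => /(_ s0).
have wuv : 0 < (u + v + w) ^+ 4 - 24 * u * v * w * (u + v + w)
    - 6 * (u * v) ^+ 2.
  have := @ternary_quartic_gt0 _ w u v w0 u0 v0.
  rewrite -addrA (addrC w) -[24 * w * u * v]mulrA [_ * w * _]mulrAC.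
  by rewrite !mulrA => /(_ s0).
move: (T 0 0 1 1) (T 0 0 2 2) (T 1 1 2 2) => a b c.
have := sqr_ge0 (u * v); rewrite /= !inE => uv0.
move=> /orP[]/eqP-> /orP[]/eqP-> /orP[]/eqP->.
(* If all three entries are 1, the form is the left side of [wuv] plus [6 * (u * v) ^+ 2], hence the
   use of [uv0]. *)
all: by rewrite ?eqxx ?[0 == 1]eq_sym ?oner_eq0 // => _; lra.
Qed.
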